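(* Let $X=\{x_1,\ldots,x_N\}\subset\mathbb{R}^n$ and $Y=\{y_1,\ldots,y_N\}\subset\mathbb{R}^m$ be two point clouds of the same size. Let $U_1$ be an orthogonal transformation of $\mathbb{R}^n$ and $X_{U_1}=\{U_1x_1,\ldots,U_1x_N\}$; let $U_2$ be an orthogonal transformation of $\mathbb{R}^m$ and $Y_{U_2}=\{U_2y_1,\ldots,U_2y_N\}$. Then $\mathrm{GNSA}(X,Y)=\mathrm{GNSA}(X_{U_1},Y_{U_2})$.
   Context: A point cloud of size $N\ge 1$ in $\mathbb{R}^n$ is a family of points $x_1,\ldots,x_N\in\mathbb{R}^n$ indexed by $1,\ldots,N$. Two point clouds of the same size may lie in spaces of different dimensions. $d(\cdot,\cdot)$ is Euclidean distance. For point clouds $X=\{x_1,\ldots,x_N\}\subset\mathbb{R}^n$ and $Y=\{y_1,\ldots,y_N\}\subset\mathbb{R}^m$ of the same size, $$\mathrm{GNSA}(X,Y)=\frac1{N^2}\sum_{1\le i,j\le N}\left|\frac{d(x_i,x_j)}{\max_{x\in X}d(x,0)}-\frac{d(y_i,y_j)}{\max_{y\in Y}d(y,0)}\right|.$$ All point clouds are assumed to contain at least one nonzero point, so that the denominators are nonzero. *)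

(* Defs.v *)
From HB Require Import structures.
From mathcomp Require Import all_boot all_order all_algebra.
From mathcomp Require Import reals.

Set Implicit Arguments.
Unset Strict Implicit.
Unset Printing Implicit Defensive.

Import Order.TTheory GRing.Theory Num.Theory.
Local Open Scope ring_scope.

(* Indexed family: points may repeat. *)
Definition point_cloud (R : realType) (N n : nat) := 'I_N -> 'cV[R]_n.

(* Not the norm of MathComp-Analysis on matrices, which is the sup norm. *)
Definition edist (R : realType) (n : nat) (u v : 'cV[R]_n) : R :=
  Num.sqrt (\sum_(k < n) (u k 0 - v k 0) ^+ 2).

(* Distances are nonnegative, so the default 0 of the iterated maximum does
   not change its value when N > 0. *)
Definition max_radius (R : realType) (N n : nat) (X : point_cloud R N n) : R :=
  \big[Num.max/0]_(i < N) edist (X i) 0.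

Definition GNSA (R : realType) (N n m : nat)
    (X : point_cloud R N n) (Y : point_cloud R N m) : R :=
  (N%:R ^+ 2)^-1 * \sum_(i < N) \sum_(j < N)
    `| edist (X i) (X j) / max_radius X - edist (Y i) (Y j) / max_radius Y |.

(* Orthogonal transformations of R^n, given by their matrices in the standard
   basis, acting on column vectors by left multiplication. *)
Definition orthogonal_transformation (R : realType) (n : nat) (U : 'M[R]_n) :
    Prop :=
  U^T *m U = 1%:M.

Definition transform (R : realType) (N n : nat) (U : 'M[R]_n)
    (X : point_cloud R N n) : point_cloud R N n :=
  fun i => U *m X i.

(* Main.v *)
Require Import Defs.
From mathcomp Require Import all_boot all_order all_algebra.
From mathcomp Require Import reals.

Import GRing.Theory.
Local Open Scope ring_scope.

(** GNSA depends on a cloud only through its pairwise distances and its largest distance to the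
    origin. An orthogonal map is linear and preserves the form [w^T *m w], so it preserves the
    former ([edist_orthogonal]); as it also fixes the origin, it preserves the latter
    ([max_radius_orthogonal]). *)

(** The matrix form lets [U^T *m U] appear and cancel by matrix algebra alone. *)
Lemma edist_mulmx (R : realType) (n : nat) (u v : 'cV[R]_n) :
  edist u v = Num.sqrt (((u - v)^T *m (u - v)) 0 0).
Proof.
rewrite /edist mxE; congr Num.sqrt.
by apply: eq_bigr => k _; rewrite !mxE expr2.
Qed.

Lemma edist_orthogonal (R : realType) (n : nat) (U : 'M[R]_n)
    (hU : orthogonal_transformation U) (u v : 'cV[R]_n) :
  edist (U *m u) (U *m v) = edist u v.
Proof.
by rewrite !edist_mulmx -mulmxBr trmx_mul mulmxA -(mulmxA _ U^T) hU mulmx1.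
Qed.

Lemma max_radius_orthogonal (R : realType) (N n : nat) (U : 'M[R]_n)
    (hU : orthogonal_transformation U) (X : point_cloud R N n) :
  max_radius (transform U X) = max_radius X.
Proof.
apply: eq_bigr => i _.
(* The origin is written as [U *m 0], so that the radius becomes a distance between two images under
   [U]. *)
by rewrite /transform -[in LHS](mulmx0 _ U) edist_orthogonal.
Qed.

Theorem lemmaB5 (R : realType) (N n m : nat) (hN : (0 < N)%N)
    (X : point_cloud R N n) (Y : point_cloud R N m)
    (hX : exists i, X i <> 0) (hY : exists i, Y i <> 0)
    (U1 : 'M[R]_n) (U2 : 'M[R]_m)
    (hU1 : orthogonal_transformation U1)
    (hU2 : orthogonal_transformation U2) :
  GNSA X Y = GNSA (transform U1 X) (transform U2 Y).
Proof.
rewrite /GNSA !max_radius_orthogonal //; congr (_ * _).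
apply: eq_bigr => i _; apply: eq_bigr => j _.
by rewrite /transform !edist_orthogonal.
Qed.
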